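(* Let $r(t)$, $t=0,1,2,\dots$, be a sequence of independent, identically distributed random variables in $\{1,\dots,\ell\}$ with probabilities $\rho_r=\mathbb{P}[r(t)=r]>0$ for every $r=1,\dots,\ell$. Assume that the hypergraph $\mathcal H$ with node set $C$ and edges $C_1,\dots,C_\ell$ is connected. Consider $x(t+1)=F_{r(t)}x(t)$ with deterministic $x(0)\in\ker\mathbf{1}^T$, let $v(t)=\mathbb{E}[x(t)^TMx(t)]$, and let $$R=\sup_{x(0)\in\ker\mathbf{1}^T}\ \limsup_{t\to\infty}\ \{v(t)\}^{1/t}.$$ Then $$R\le\beta<1,\qquad\text{where}\quad \beta=\max\{|\lambda|\;:\;\lambda\text{ eigenvalue of }F_{\mathrm{ave}},\ \lambda\neq1\},\qquad F_{\mathrm{ave}}:=\mathbb{E}[F_r]=\sum_{r=1}^\ell\rho_rF_r.$$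
   Context: Let $G$ be a finite directed graph with node set $V$, $|V|=n$, a distinguished node $0$, and edge set $E$ (each edge $e$ going from $\sigma(e)$ to $\tau(e)$), connected irrespective of edge orientation. $A\in\{0,\pm1\}^{|E|\times n}$ is the incidence matrix: $[A]_{ev}=-1$ if $v=\sigma(e)$, $1$ if $v=\tau(e)$, $0$ otherwise. Each edge has an impedance $z_e\in\mathbb{C}$ with $\mathrm{Re}(z_e)>0$; $Z=\mathrm{diag}(z_e)$, $L=A^TZ^{-1}A$, and $X\in\mathbb{C}^{n\times n}$ is the unique symmetric matrix with $XL=I-\mathbf{1}\mathbf{1}_0^T$, $X\mathbf{1}_0=0$ (with $\mathbf{1}$ the all-ones vector, $\mathbf{1}_0$ the basis vector of node $0$). $C\subseteq V$ is the set of compensators, $m=|C|\ge2$, and $M\in\mathbb{R}^{m\times m}$ is the principal submatrix of $\mathrm{Re}(X)$ indexed by $C$. The clusters $C_1,\dots,C_\ell$ are nonempty, possibly overlapping subsets of $C$ with $\bigcup_rC_r=C$. Vectors in $\mathbb{R}^m$ are indexed by $C$; $\mathbf{1}_{C_r}\in\mathbb{R}^m$ is the indicator vector of $C_r$, and $$\Omega_r:=\mathrm{diag}(\mathbf{1}_{C_r})-\frac{1}{|C_r|}\mathbf{1}_{C_r}\mathbf{1}_{C_r}^T,\qquad F_r:=I-(\Omega_rM\Omega_r)^\sharp M,$$ where $\sharp$ denotes the Moore–Penrose pseudoinverse. $\ker\mathbf{1}^T=\{x\in\mathbb{R}^m:\sum_kx_k=0\}$. A hypergraph is connected if any two nodes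 are joined by a chain of hyperedges in which consecutive hyperedges intersect. *)

(* Defs.v *)
From HB Require Import structures.
From mathcomp Require Import all_boot all_order all_algebra.
From mathcomp Require Import complex.
From mathcomp Require Import all_classical all_reals all_analysis.

Set Implicit Arguments.
Unset Strict Implicit.
Unset Printing Implicit Defensive.

Import Order.TTheory GRing.Theory Num.Theory.
Local Open Scope classical_set_scope.
Local Open Scope ring_scope.

(* Nodes are 'I_n and edges are 'I_p, so parallel edges are allowed. *)

Section Network.
Variables (n p : nat) (sigma tau : 'I_p -> 'I_n).

Definition joined : rel 'I_n := fun u v =>
  [exists e, ((sigma e == u) && (tau e == v)) || ((sigma e == v) && (tau e == u))].

Definition graph_connected := forall u v : 'I_n, connect joined u v.

(* Only meaningful when [sigma e != tau e] for every edge [e]. *)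
Definition incidence (K : pzRingType) : 'M[K]_(p, n) :=
  \matrix_(e, v) (if v == sigma e then -1 else if v == tau e then 1 else 0).

Definition laplacian (R : realType) (z : 'I_p -> R[i]) : 'M[R[i]]_n :=
  (incidence R[i])^T *m invmx (diag_mx (\row_e z e)) *m incidence R[i].

(* These conditions determine [X] uniquely when the graph is connected and all
   impedances have positive real part. *)
Definition is_green_matrix (R : realType) (z : 'I_p -> R[i]) (o : 'I_n)
    (X : 'M[R[i]]_n) :=
  [/\ X^T = X,
      X *m laplacian z = 1%:M - const_mx 1 *m (delta_mx o 0 : 'cV_n)^T
    & X *m (delta_mx o 0 : 'cV_n) = 0].

End Network.

(* Square matrices of size #|C| have their rows and columns indexed by the
   elements of [C] through [enum_val]. *)

Definition compensator_matrix (R : realType) (n : nat) (X : 'M[R[i]]_n)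
    (C : {set 'I_n}) : 'M[R]_#|C| :=
  \matrix_(i, j) complex.Re (X (enum_val i) (enum_val j)).

Definition clusters_connected (n l : nat) (C : {set 'I_n})
    (Cl : 'I_l -> {set 'I_n}) :=
  forall u v, u \in C -> v \in C ->
    exists r s, [/\ u \in Cl r, v \in Cl s
      & connect (fun a b => ~~ [disjoint Cl a & Cl b]) r s].

Section PseudoInverse.
Variables (R : realType) (m : nat).

Definition moore_penrose (A B : 'M[R]_m) :=
  [/\ A *m B *m A = A, B *m A *m B = B,
      (A *m B)^T = A *m B & (B *m A)^T = B *m A].

Definition mp_pinv (A : 'M[R]_m) : 'M[R]_m := xget 0 [set B | moore_penrose A B].

Lemma moore_penrose_unique (A B B' : 'M[R]_m) :
  moore_penrose A B -> moore_penrose A B' -> B = B'.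
Proof.
move=> [a1 a2 a3 a4] [b1 b2 b3 b4].
have e1 : A *m B = A *m B'.
  by rewrite -{1}b1 -mulmxA -b3 -a3 -trmx_mul mulmxA a1 b3.
have e2 : B *m A = B' *m A.
  by rewrite -{1}b1 -[A *m B' *m A]mulmxA mulmxA -a4 -b4 -trmx_mul -mulmxA
    (mulmxA A) a1 b4.
by rewrite -a2 e2 -mulmxA e1 mulmxA b2.
Qed.

Lemma gram_row_free_unitmx (k q : nat) (A : 'M[R]_(k, q)) :
  row_free A -> A *m A^T \in unitmx.
Proof.
move=> fA; rewrite -row_free_unit; apply/inj_row_free => v.
move=> vAA; have : (v *m A) *m (v *m A)^T = 0.
  by rewrite trmx_mul mulmxA -(mulmxA v) vAA mul0mx.
move=> /matrixP/(_ 0 0); rewrite !mxE => /eqP.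
under eq_bigr do rewrite [X in _ * X]mxE -expr2.
rewrite psumr_eq0 => [/allP h|i _]; last exact: sqr_ge0.
apply: (row_free_inj fA); rewrite mul0mx; apply/rowP => j; rewrite [RHS]mxE.
by have := h j (mem_index_enum _); rewrite sqrf_eq0 => /eqP.
Qed.

Lemma moore_penrose_full_rank (k : nat) (S : 'M[R]_(m, k)) (Q : 'M[R]_(k, m)) :
  row_full S -> row_free Q ->
  moore_penrose (S *m Q)
    (Q^T *m (invmx (Q *m Q^T) *m (invmx (S^T *m S) *m S^T))).
Proof.
move=> fS fQ.
have uQ : Q *m Q^T \in unitmx by exact: gram_row_free_unitmx.
have uS : S^T *m S \in unitmx.
  rewrite -{2}(trmxK S); apply: gram_row_free_unitmx.
  by rewrite /row_free mxrank_tr.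
have tQ : (Q *m Q^T)^T = Q *m Q^T by rewrite trmx_mul trmxK.
have tS : (S^T *m S)^T = S^T *m S by rewrite trmx_mul trmxK.
set iQ := invmx (Q *m Q^T); set iS := invmx (S^T *m S).
have eQ q (Y : 'M[R]_(k, q)) : Q *m (Q^T *m (iQ *m Y)) = Y.
  by rewrite !mulmxA mulmxV// mul1mx.
have eS q (Y : 'M[R]_(k, q)) : iS *m (S^T *m (S *m Y)) = Y.
  by rewrite (mulmxA S^T) (mulmxA iS) /iS mulVmx// mul1mx.
have tiQ : iQ^T = iQ by rewrite /iQ trmx_inv tQ.
have tiS : iS^T = iS by rewrite /iS trmx_inv tS.
split.
- by rewrite -!mulmxA eS eQ.
- by rewrite -!mulmxA eS eQ.
- by rewrite -!mulmxA eQ !trmx_mul trmxK tiS mulmxA.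
- by rewrite -!mulmxA eS !trmx_mul trmxK tiQ mulmxA.
Qed.

Lemma moore_penrose_exists (A : 'M[R]_m) : exists B, moore_penrose A B.
Proof.
have := moore_penrose_full_rank (col_base_full A) (row_base_free A).
by rewrite mulmx_base => h; eexists; exact: h.
Qed.

Lemma mp_pinvP (A : 'M[R]_m) : moore_penrose A (mp_pinv A).
Proof. by have [B hB] := moore_penrose_exists A; exact: (xgetPex 0 (ex_intro _ B hB)). Qed.

End PseudoInverse.

Section Updates.
Variables (R : realType) (n : nat) (C : {set 'I_n}).

Definition indicator (D : {set 'I_n}) : 'cV[R]_#|C| :=
  \col_i (enum_val i \in D)%:R.

Definition cluster_proj (D : {set 'I_n}) : 'M[R]_#|C| :=
  diag_mx (indicator D)^T
  - (#|D|%:R)^-1 *: (indicator D *m (indicator D)^T).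

Definition cluster_update (M : 'M[R]_#|C|) (D : {set 'I_n}) : 'M[R]_#|C| :=
  1%:M - mp_pinv (cluster_proj D *m M *m cluster_proj D) *m M.

End Updates.

Section Dynamics.
Variables (R : realType) (m l : nat).

Definition ker_ones : set 'cV[R]_m := [set x | \sum_k x k 0 = 0].

Fixpoint trajectory (F : 'I_l -> 'M[R]_m) (r : nat -> 'I_l) (x0 : 'cV[R]_m)
    (t : nat) : 'cV[R]_m :=
  if t is t'.+1 then F (r t') *m trajectory F r x0 t' else x0.

Definition mean_update (rho : 'I_l -> R) (F : 'I_l -> 'M[R]_m) : 'M[R]_m :=
  \sum_k rho k *: F k.

(* The eigenvalues of a real matrix are its complex ones. *)
Definition nonunit_eigenvalue_moduli (A : 'M[R]_m) : set R :=
  [set complex.Re `|lambda| | lambda in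
    [set lambda : R[i] |
      eigenvalue (map_mx (real_complex R) A) lambda /\ lambda != 1]].

Definition is_max (S : set R) (b : R) := S b /\ ubound S b.

End Dynamics.

Section Probability.
Context {d : measure_display} {T : measurableType d} {R : realType}.
Variables (P : probability T R) (l : nat).

(* 'I_l carries the discrete sigma-algebra. *)
Definition random_index (r : T -> 'I_l) :=
  forall B : set 'I_l, measurable (r @^-1` B).

Definition mutually_independent (r : nat -> T -> 'I_l) :=
  forall (s : seq nat) (B : nat -> set 'I_l), uniq s ->
    P (\bigcap_(t in [set` s]) (r t @^-1` B t))
    = (\prod_(t <- s) P (r t @^-1` B t))%E.

Definition iid (r : nat -> T -> 'I_l) (rho : 'I_l -> R) :=
  [/\ forall t, random_index (r t), mutually_independent r
    & forall t k, P (r t @^-1` [set k]) = (rho k)%:E].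

Definition mean_energy (m : nat) (M : 'M[R]_m) (F : 'I_l -> 'M[R]_m)
    (r : nat -> T -> 'I_l) (x0 : 'cV[R]_m) (t : nat) : \bar R :=
  let energy w : R :=
    let x := trajectory F (r ^~ w) x0 t in (x^T *m M *m x) 0 0 in
  'E_P[energy]%E.

(* The term [t = 0], where [0^-1 = 0], does not affect the limit superior. *)
Definition convergence_rate (m : nat) (M : 'M[R]_m) (F : 'I_l -> 'M[R]_m)
    (r : nat -> T -> 'I_l) : \bar R :=
  ereal_sup [set limn_esup (fun t => (mean_energy M F r x0 t `^ (t%:R^-1)%R)%E)
    | x0 in @ker_ones R m].

End Probability.

(* Main.v *)
(* Let [N_k] be the pseudoinverse of [Omega_k M Omega_k], so that
   [F_k = 1 - N_k M]. Then [N_k] is symmetric, [N_k M N_k = N_k] and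
   [1^T N_k = 0]; hence [F_k] fixes the row [1^T], and
   [F_k^T M F_k = M F_k]. Conditioning on [x(t)] therefore gives
   [v(t+1) = E (x(t)^T M F_ave x(t))].

   The matrix [H = M + 1 1^T] is positive definite, because [M] is positive
   semidefinite and vanishes on no nonzero vector of zero sum: for
   [u = X y], [y^T Re(X) y] is the power [sum_e |(A u)_e|^2 Re (1 / z_e)]
   dissipated in the network. As [H F_ave = M F_ave + 1 1^T] is symmetric,
   [F_ave] is diagonalizable and [H]-self-adjoint, with eigenvalues in [0, 1].
   A vector [x] fixed by [F_ave] has [M x] constant on every cluster, hence
   constant, so it is [H]-orthogonal to the vectors of zero sum. On the latter,
   [x^T M F_ave x <= beta x^T M x] with [beta < 1] the largest eigenvalue other
   than 1, which yields [v(t) <= beta ^ t v(0)]. *)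

Require Import Defs.
From HB Require Import structures.
From mathcomp Require Import all_boot all_order all_algebra.
From mathcomp Require Import complex ring.
From mathcomp Require Import all_classical all_reals all_analysis.
From mathcomp Require Import measurable_realfun.

Set Implicit Arguments.
Unset Strict Implicit.
Unset Printing Implicit Defensive.

Import Order.TTheory GRing.Theory Num.Theory.
Import numFieldNormedType.Exports.
Local Open Scope classical_set_scope.
Local Open Scope ring_scope.
Local Open Scope sesquilinear_scope.

(** * Real forms and complex diagonalization *)

Section ComplexParts.
Variable R : realType.

Lemma Re_sum (I : Type) (s : seq I) (P : pred I) (f : I -> R[i]) :
  complex.Re (\sum_(i <- s | P i) f i) = \sum_(i <- s | P i) complex.Re (f i).
Proof.
exact: (big_morph (@complex.Re R) (raddfD (@complex.Re R : Rcomplex R -> R)) erefl).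
Qed.

Lemma Re_scale (a : R) (w : R[i]) : complex.Re (a%:C%C * w) = a * complex.Re w.
Proof. by case: w => b c /=; rewrite mul0r subr0. Qed.

Lemma Im_scale (a : R) (w : R[i]) : complex.Im (a%:C%C * w) = a * complex.Im w.
Proof. by case: w => b c /=; rewrite mul0r addr0. Qed.

Lemma Im_sum (I : Type) (s : seq I) (P : pred I) (f : I -> R[i]) :
  complex.Im (\sum_(i <- s | P i) f i) = \sum_(i <- s | P i) complex.Im (f i).
Proof.
exact: (big_morph (@complex.Im R) (raddfD (@complex.Im R : Rcomplex R -> R)) erefl).
Qed.

End ComplexParts.

Definition quad (R : pzRingType) m (Q : 'M[R]_m) (x : 'cV[R]_m) : R :=
  (x^T *m Q *m x) 0 0.

Section RealForms.
Variables (R : realType) (m : nat).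
Implicit Types (Q F H : 'M[R]_m) (u v : 'cV[R[i]]_m) (a b : 'cV[R]_m).
Local Notation toC := (map_mx (real_complex R)).

Lemma bilinear_symmetric Q a b : Q^T = Q ->
  (a^T *m Q *m b) 0 0 = (b^T *m Q *m a) 0 0.
Proof.
move=> sQ; transitivity ((a^T *m Q *m b)^T 0 0); first by rewrite [RHS]mxE.
by rewrite !trmx_mul trmxK sQ mulmxA.
Qed.

Lemma toC_adj p q (A : 'M[R]_(p, q)) : (toC A)^t* = toC A^T.
Proof. by apply/matrixP => i j; rewrite !mxE; exact: conjc_real. Qed.

Lemma toC_rect u :
  u = toC (map_mx (@complex.Re R) u) + 'i *: toC (map_mx (@complex.Im R) u).
Proof. by apply/matrixP => i j; rewrite !mxE [LHS]complexE complexiE. Qed.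

(** The cross terms ['i * (a^T Q b - b^T Q a)] cancel because [Q] is symmetric. *)
Lemma quad_complex Q u : Q^T = Q ->
  (u^t* *m toC Q *m u) 0 0 =
  (quad Q (map_mx (@complex.Re R) u) + quad Q (map_mx (@complex.Im R) u))%:C%C.
Proof.
move=> sQ; rewrite {1 2}(toC_rect u).
set a := map_mx _ u; set b := map_mx _ u.
have -> : (toC a + 'i *: toC b)^t* = toC a^T - 'i *: toC b^T.
  apply/matrixP => i j; rewrite !mxE rmorphD rmorphM /= conjCi mulNr.
  by congr (_ - _ * _); exact: conjc_real.
rewrite !(mulmxDl, mulmxDr, mulNmx).
rewrite -!scalemxAr -!scalemxAl -!map_mxM.
rewrite -?map_mxM scalerA -expr2 sqrCi scaleN1r /quad.
have := bilinear_symmetric a b sQ.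
set x := a^T *m Q *m b; set y := b^T *m Q *m a; move=> xy.
have -> : x = y by apply/matrixP => i j; rewrite !ord1.
by rewrite opprK addrA subrK !mxE rmorphD.
Qed.


Lemma adjM p q s (A : 'M[R[i]]_(p, q)) (B : 'M[R[i]]_(q, s)) :
  (A *m B)^t* = B^t* *m A^t*.
Proof. by rewrite trmx_mul map_mxM. Qed.

Lemma adj_diag p (e : 'rV[R]_p) :
  (diag_mx (toC e))^t* = diag_mx (toC e).
Proof.
apply/matrixP => i j; rewrite !mxE eq_sym rmorphMn /=.
by case: eqP => [->|]; rewrite ?mulr0n //= !mulr1n; exact: conjc_real.
Qed.

Lemma hermitian_diagonalization (A : 'M[R[i]]_m) : A^t* = A ->
  exists (U : 'M[R[i]]_m) (e : 'rV[R]_m),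
    [/\ U \is unitarymx & A = U^t* *m diag_mx (toC e) *m U].
Proof.
move=> hA; have hsA : A \is hermsymmx by apply/is_hermitianmxP; rewrite scale1r hA.
have uU := spectral_unitarymx A.
exists (spectralmx A), (map_mx (@complex.Re R) (spectral_diag A)); split=> //.
rewrite {1}(orthomx_spectralP (hermitian_normalmx hsA)) invmx_unitary //.
congr (_ *m diag_mx _ *m _); apply/rowP => i; rewrite !mxE.
by rewrite RRe_real //; have /mxOverP := hermitian_spectral_diag_real hsA.
Qed.

(* [T] is a unitary matrix times a square root of [H], the unitary matrix
   diagonalizing [F] conjugated by that square root. *)
Lemma selfadjoint_diagonalization H F : H^T = H ->
  (forall x : 'cV[R]_m, x != 0 -> 0 < quad H x) -> (H *m F)^T = H *m F ->
  exists (T : 'M[R[i]]_m) (e : 'rV[R]_m),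
    [/\ T \in unitmx, T^t* *m T = toC H
      & T *m toC F = diag_mx (toC e) *m T].
Proof.
move=> sH pH sHF.
have [U [e [uU eH]]] : exists (U : 'M[R[i]]_m) (e : 'rV[R]_m),
    [/\ U \is unitarymx & toC H = U^t* *m diag_mx (toC e) *m U].
  by apply: hermitian_diagonalization; rewrite toC_adj sH.
have UU : U *m U^t* = 1%:M by apply/unitarymxP.
(* [e 0 i] is the value of the form [H] at column [i] of the inverse of [U]. That column is nonzero,
   so its real or its imaginary part is nonzero. *)
have e_gt0 i : 0 < e 0 i.
  have : U *m toC H *m U^t* = diag_mx (toC e).
    by rewrite eH !mulmxA UU mul1mx -mulmxA UU mulmx1.
  set u := col i (U^t* ).
  move=> /matrixP/(_ i i).
  have -> : (U *m toC H *m U^t* ) i i = (u^t* *m toC H *m u) 0 0.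
    have -> : u^t* = row i U.
      by apply/rowP => j; rewrite !mxE; exact: conjCK.
    by rewrite -row_mul !mxE; apply: eq_bigr => j _; rewrite !mxE.
  rewrite quad_complex // !mxE eqxx mulr1n => /complexI <-.
  have quad0 : quad H 0 = 0 by rewrite /quad trmx0 !mul0mx mxE.
  have quad_ge0 (x : 'cV_m) : 0 <= quad H x.
    by have [->|/pH/ltW//] := eqVneq x 0; rewrite quad0.
  have [a0|/pH a0] := eqVneq (map_mx (@complex.Re R) u) 0; last exact: ltr_wpDr.
  have [b0|/pH b0] := eqVneq (map_mx (@complex.Im R) u) 0; last exact: ltr_wpDl.
  have u0 : u = 0 by rewrite (toC_rect u) a0 b0 !map_mx0 scaler0 addr0.
  have : row i U *m u = 0 by rewrite u0 mulmx0.
  move=> /matrixP/(_ 0 0); have /matrixP/(_ i i) := UU.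
  rewrite !mxE eqxx => U1 U0; move: U1.
  rewrite [LHS](_ : _ = 0); first by move/esym/eqP; rewrite oner_eq0.
  by rewrite -[RHS]U0; apply: eq_bigr => j _; rewrite !mxE.
pose q := map_mx Num.sqrt e.
pose S := diag_mx (toC q) *m U.
have SS : S^t* *m S = toC H.
  rewrite adjM adj_diag eH !mulmxA -(mulmxA (U^t* )) mulmx_diag.
  congr (_ *m diag_mx _ *m _); apply/rowP => i; rewrite !mxE -rmorphM /=.
  by rewrite -expr2 sqr_sqrtr // ltW.
have uS : S \in unitmx.
  rewrite unitmx_mul (unitarymx_unit uU) andbT unitmxE det_diag unitfE.
  apply/prodf_neq0 => i _; rewrite !mxE fmorph_eq0.
  by rewrite sqrtr_eq0 -ltNge.
clearbody S.
have [V [f [uV eV]]] : exists (V : 'M[R[i]]_m) (f : 'rV[R]_m),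
    [/\ V \is unitarymx &
      S *m toC F *m invmx S = V^t* *m diag_mx (toC f) *m V].
  apply: hermitian_diagonalization.
  have uSt : S^t* \in unitmx by rewrite map_unitmx unitmx_tr.
  (* Multiplied by [S^t*] on the left and by [S] on the right, the hermitian symmetry of [S F S^-1]
     becomes the symmetry of [H F]. *)
  apply: (can_inj (mulKmx uSt)); apply: (can_inj (mulmxK uS)).
  have e1 : S^t* *m (invmx S)^t* = 1%:M by rewrite -adjM mulVmx // trmx1 map_mx1.
  rewrite !adjM !mulmxA e1 mul1mx -(mulmxA _ (S^t* ) S) SS mulmxKV // toC_adj.
  by rewrite -!map_mxM -{1}sH -trmx_mul sHF.
exists (V *m S), f; split.
- by rewrite unitmx_mul uS (unitarymx_unit uV).
- rewrite adjM mulmxA -(mulmxA (S^t* )).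
  by rewrite -[V^t*]invmx_unitary // mulVmx ?mulmx1 ?unitarymx_unit.
- rewrite -mulmxA -[S *m _](mulmxKV uS) eV !mulmxA.
  by rewrite (unitarymxP uV) // mul1mx.
Qed.

End RealForms.

(** * The dissipated power *)

Section Green.
Variables (R : realType) (n p : nat) (o : 'I_n) (sigma tau : 'I_p -> 'I_n).
Variables (z : 'I_p -> R[i]) (X : 'M[R[i]]_n).
Hypothesis zpos : forall e, 0 < complex.Re (z e).
Hypothesis greenX : is_green_matrix sigma tau z o X.
Local Notation toC := (map_mx (real_complex R)).
Local Notation A := (incidence sigma tau R[i]).
Local Notation L := (laplacian sigma tau z).
Local Notation ReX := (map_mx (@complex.Re R) X).

Lemma z_neq0 e : z e != 0.
Proof. by apply/eqP => z0; have := zpos e; rewrite z0 ltxx. Qed.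

Lemma invmx_impedance :
  invmx (diag_mx (\row_e z e)) = diag_mx (\row_e (z e)^-1).
Proof.
have uz : diag_mx (\row_e z e) \in unitmx.
  by rewrite unitmxE det_diag unitfE; apply/prodf_neq0 => e _; rewrite mxE z_neq0.
apply: (can_inj (mulKmx uz)); rewrite mulmxV // mulmx_diag.
by apply/matrixP => i j; rewrite !mxE mulfV ?z_neq0.
Qed.

Lemma laplacian_green :
  L *m X = 1%:M - (delta_mx o 0 : 'cV_n) *m (const_mx 1 : 'cV_n)^T.
Proof.
case: greenX => sX XL _.
have sL : L^T = L.
  by rewrite /laplacian invmx_impedance !trmx_mul trmxK tr_diag_mx mulmxA.
by rewrite -sL -{1}sX -trmx_mul XL linearB /= trmx1 trmx_mul trmxK.
Qed.

(** The last factor is [Re (1 / y)], so this is the power lost in an impedance [y] under a voltage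
    [w]. *)
Lemma Re_dissipation (w y : R[i]) :
  complex.Re (w^* * y^-1 * w) =
  (complex.Re w ^+ 2 + complex.Im w ^+ 2) *
  (complex.Re y / (complex.Re y ^+ 2 + complex.Im y ^+ 2)).
Proof. by case: w y => a b [c e] /=; ring. Qed.

Lemma quad_green (y : 'cV[R]_n) (w := A *m (X *m toC y)) :
  quad ReX y = \sum_e (complex.Re (w e 0) ^+ 2 + complex.Im (w e 0) ^+ 2) *
  (complex.Re (z e) / (complex.Re (z e) ^+ 2 + complex.Im (z e) ^+ 2)).
Proof.
case: (greenX) => sX XL Xo.
have aA : A^t* = A^T.
  apply/matrixP => i j; rewrite !mxE.
  by case: eqP => _; [rewrite rmorphN rmorph1|case: eqP => _; rewrite ?rmorph1 ?rmorph0].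
pose u := X *m toC y.
(* [L X] differs from the identity by a rank-one term whose column is the basis vector of [o]. Since
   [X] kills that vector, so does [u^t*]. *)
have uLu : u^t* *m (L *m u) = u^t* *m toC y.
  rewrite /u mulmxA laplacian_green mulmxBl mul1mx mulmxBr.
  rewrite [X in _ - X](_ : _ = 0) ?subr0 // !mulmxA adjM.
  have -> : X^t* = map_mx Num.conj X by rewrite sX.
  rewrite -(mulmxA _ (map_mx Num.conj X)).
  have -> : map_mx Num.conj X *m (delta_mx o 0 : 'cV_n) = 0.
    have -> : (delta_mx o 0 : 'cV[R[i]]_n) = map_mx Num.conj (delta_mx o 0).
      by apply/matrixP => i j; rewrite !mxE rmorph_nat.
    by rewrite -map_mxM Xo map_mx0.
  by rewrite mulmx0 !mul0mx.
have wZw : u^t* *m (L *m u) = w^t* *m diag_mx (\row_e (z e)^-1) *m w.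
  by rewrite /w -/u [(A *m u)^t* ]adjM aA /laplacian invmx_impedance !mulmxA.
have -> : quad ReX y = complex.Re ((u^t* *m toC y) 0 0).
  rewrite adjM toC_adj.
  have -> : X^t* = toC ReX - 'i *: toC (map_mx (@complex.Im R) X).
    rewrite sX; apply/matrixP => i j; rewrite !mxE.
    rewrite -complexiE; case: (X i j) => a b; apply/eqP.
    by rewrite eq_complex /=; apply/andP; split; apply/eqP; ring.
  rewrite mulmxBr mulmxBl -scalemxAr -scalemxAl -!map_mxM !mxE -complexiE /=.
  by rewrite /quad !mxE; ring.
rewrite -uLu wZw !mxE Re_sum; apply: eq_bigr => e _.
by rewrite -Re_dissipation mul_mx_diag !mxE.
Qed.

Lemma quad_green_ge0 y : 0 <= quad ReX y.
Proof.
rewrite quad_green; apply: sumr_ge0 => e _.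
by rewrite mulr_ge0 ?divr_ge0 ?addr_ge0 ?sqr_ge0 // ltW.
Qed.

(** Every edge has positive conductance, so no dissipation forces [A X y = 0] and hence [L X y = 0];
    on vectors of zero sum, [L X y = y]. *)
Lemma quad_green_eq0 y : quad ReX y = 0 -> \sum_i y i 0 = 0 -> y = 0.
Proof.
rewrite quad_green => /eqP; rewrite psumr_eq0 => [/allP w0 y0|e _]; last first.
  by rewrite mulr_ge0 ?divr_ge0 ?addr_ge0 ?sqr_ge0 // ltW.
have Au0 : A *m (X *m toC y) = 0.
  apply/matrixP => e j; rewrite ord1 [RHS]mxE.
  have := w0 e (mem_index_enum _); rewrite mulf_eq0 => /orP[|].
    rewrite paddr_eq0 ?sqr_ge0 // !sqrf_eq0 => /andP[/eqP a0 /eqP b0].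
    by apply/eqP; rewrite eq_complex a0 b0 !eqxx.
  by rewrite gt_eqF // divr_gt0 // ltr_pwDl ?sqr_ge0 // exprn_gt0.
have : L *m X *m toC y = 0 by rewrite -mulmxA /laplacian -!mulmxA Au0 !mulmx0.
rewrite laplacian_green mulmxBl mul1mx -mulmxA [X in _ - _ *m X](_ : _ = 0).
  rewrite mulmx0 subr0 => /matrixP y1; apply/matrixP => i j.
  by have := y1 i j; rewrite !mxE => /complexI.
apply/matrixP => i j; rewrite !ord1 !mxE -[RHS](rmorph0 (real_complex R)) -y0 rmorph_sum.
by apply: eq_bigr => k _; rewrite !mxE mul1r.
Qed.

End Green.

(** * Cluster updates *)

Section Cluster.
Variables (R : realType) (n : nat) (C D : {set 'I_n}).
Hypotheses (DC : D \subset C) (D0 : D != finset.set0).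
Local Notation v := (@indicator R n C D).
Local Notation Om := (@cluster_proj R n C D).
Local Notation ones := (const_mx 1 : 'rV[R]_#|C|).

Lemma sum_indicator : \sum_i v i 0 = #|D|%:R.
Proof.
transitivity (\sum_(i in C) (i \in D)%:R : R).
  by rewrite [RHS]big_enum_val; apply: eq_bigr => i _; rewrite mxE.
rewrite -natr_sum -big_mkcondr -sum1_card; congr (_ %:R); apply: eq_bigl => i.
by have /fintype.subsetP/(_ i) := DC; case: (i \in D) => [->|]; rewrite ?andbF.
Qed.

Lemma card_neq0 : #|D|%:R != 0 :> R.
Proof. by rewrite pnatr_eq0 cards_eq0. Qed.

Lemma ones_indicator : ones *m v = #|D|%:R%:M.
Proof.
apply/matrixP => i j; rewrite !ord1 !mxE eqxx mulr1n -sum_indicator.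
by apply: eq_bigr => k _; rewrite mxE mul1r.
Qed.

Lemma ones_diag_indicator : ones *m diag_mx v^T = v^T.
Proof. by rewrite mul_mx_diag; apply/rowP => i; rewrite !mxE mul1r. Qed.

Lemma diag_indicatorK : diag_mx v^T *m v = v.
Proof. by rewrite mul_diag_mx; apply/colP => i; rewrite !mxE -natrM mulnb andbb. Qed.

Lemma tr_indicatorK : v^T *m v = #|D|%:R%:M.
Proof. by rewrite -ones_diag_indicator -mulmxA diag_indicatorK ones_indicator. Qed.

Lemma cluster_proj_sym : Om^T = Om.
Proof. by rewrite linearB /= tr_diag_mx linearZ /= trmx_mul trmxK. Qed.

(** The rank-one part contributes nothing because [Om v = 0]. [Om] is the orthogonal projection onto
    the zero-sum vectors supported in [D]. *)
Lemma cluster_proj_idem : Om *m Om = Om.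
Proof.
rewrite {2}/cluster_proj mulmxBr {1}/cluster_proj mulmxBl mulmx_diag.
rewrite [X in _ - X](_ : _ = 0); last first.
  rewrite -scalemxAr mulmxA /cluster_proj mulmxBl diag_indicatorK.
  rewrite -scalemxAl -mulmxA tr_indicatorK mul_mx_scalar scalerA.
  by rewrite mulVf ?card_neq0 // scale1r subrr mul0mx scaler0.
rewrite subr0 -scalemxAl -mulmxA.
have -> : v^T *m diag_mx v^T = v^T.
  by rewrite -[LHS]trmxK trmx_mul tr_diag_mx trmxK diag_indicatorK.
congr (diag_mx _ - _); apply/rowP => i.
by rewrite !mxE -natrM mulnb andbb.
Qed.

Lemma ones_cluster_proj : ones *m Om = 0.
Proof.
rewrite mulmxBr ones_diag_indicator -scalemxAr mulmxA ones_indicator.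
by rewrite mul_scalar_mx scalerA mulVf ?card_neq0 // scale1r subrr.
Qed.

Lemma cluster_proj_eq0 (x : 'cV_#|C|) (i j : 'I_#|C|) : Om *m x = 0 ->
  enum_val i \in D -> enum_val j \in D -> x i 0 = x j 0.
Proof.
rewrite mulmxBl => /matrixP x0 iD jD.
(* The common value is the mean of [x] over [D]. *)
suff x_eq k : enum_val k \in D -> x k 0 = #|D|%:R^-1 * (v^T *m x) 0 0 by rewrite !x_eq.
move=> kD; have := x0 k 0; rewrite mul_diag_mx -scalemxAl -mulmxA.
rewrite mxE [X in X + _]mxE !(mxE, kD) mul1r big_ord1.
move/eqP; rewrite subr_eq0 => /eqP ->; rewrite !mxE kD mul1r.
by congr (_ * _); apply: eq_bigr => i' _; rewrite !mxE.
Qed.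

End Cluster.

Lemma moore_penrose_tr (R : realType) m (A B : 'M[R]_m) :
  moore_penrose A B -> moore_penrose A^T B^T.
Proof.
by move=> [e1 e2 e3 e4]; split; rewrite -!trmx_mul ?mulmxA ?e1 ?e2 ?e3 ?e4.
Qed.

(** * Pseudoinverse of a form compressed by an orthogonal projection *)

Section ReducedInverse.
Variables (R : realType) (m : nat) (M Om : 'M[R]_m).
Hypothesis sM : M^T = M.
Hypothesis M_eq0 : forall x, quad M x = 0 -> ker_ones x -> x = 0.
Hypotheses (sOm : Om^T = Om) (OmOm : Om *m Om = Om).
Hypothesis ones_Om : (const_mx 1 : 'rV_m) *m Om = 0.
Local Notation A := (Om *m M *m Om).
Local Notation N := (mp_pinv A).

Lemma ker_onesP (x : 'cV[R]_m) : ker_ones x <-> (const_mx 1 : 'rV_m) *m x = 0.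
Proof.
have sum_ones : ((const_mx 1 : 'rV_m) *m x) 0 0 = \sum_k x k 0.
  by rewrite mxE; apply: eq_bigr => k _; rewrite mxE mul1r.
rewrite /ker_ones /= -sum_ones; split => [x0|->]; last by rewrite mxE.
by apply/matrixP => i j; rewrite !ord1 x0 mxE.
Qed.

Lemma pinv_sym : N^T = N.
Proof.
apply: (moore_penrose_unique (A := A) _ (mp_pinvP A)).
have := moore_penrose_tr (mp_pinvP A).
by rewrite [X in moore_penrose X _](_ : _ = A) // !trmx_mul sM sOm mulmxA.
Qed.

(** As [N = (N A)^T N], the range of [N] lies in that of [A^T], hence in that of [Om]. *)
Lemma proj_pinv : Om *m N = N.
Proof.
have [e1 e2 e3 e4] := mp_pinvP A.
by rewrite -e2 -e4 trmx_mul !trmx_mul sOm !mulmxA OmOm.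
Qed.

Lemma pinv_proj : N *m Om = N.
Proof. by rewrite -[LHS]trmxK trmx_mul sOm pinv_sym proj_pinv pinv_sym. Qed.

(** In [N A N = N], both factors [Om] of [A] are absorbed by [N]. *)
Lemma pinv_reflexive : N *m M *m N = N.
Proof.
have [_ e2 _ _] := mp_pinvP A.
by rewrite -[RHS]e2 -{1}pinv_proj -{2}proj_pinv !mulmxA.
Qed.

Lemma ones_pinv : (const_mx 1 : 'rV_m) *m N = 0.
Proof. by rewrite -proj_pinv mulmxA ones_Om mul0mx. Qed.

(** [A] and [N] are symmetric and commute, so [A y = A N A y = A A N y = 0]. Then the form [M]
    vanishes at [Om y], a vector of zero sum. *)
Lemma pinv_eq0 (y : 'cV[R]_m) : N *m y = 0 -> Om *m y = 0.
Proof.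
move=> Ny; have [e1 _ e3 _] := mp_pinvP A.
have sA : A^T = A by rewrite !trmx_mul sM sOm mulmxA.
have Ay : A *m y = 0.
  have AN : A *m N = N *m A by rewrite -e3 trmx_mul pinv_sym sA.
  by rewrite -[X in X *m y]e1 -(mulmxA A) -AN -(mulmxA A (A *m N)) -(mulmxA A N) Ny !mulmx0.
apply: M_eq0; last by apply/ker_onesP; rewrite mulmxA ones_Om mul0mx.
have e : y^T *m Om *m M *m (Om *m y) = y^T *m (A *m y) by rewrite !mulmxA.
by rewrite /quad trmx_mul sOm e Ay mulmx0 mxE.
Qed.

End ReducedInverse.

(** * The spectrum of the mean update *)

Section MeanUpdate.
Variables (R : realType) (m l : nat) (M : 'M[R]_m) (N : 'I_l -> 'M[R]_m).
Variable rho : 'I_l -> R.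
Hypotheses (m_ge2 : (2 <= m)%N) (sM : M^T = M) (M_ge0 : forall x, 0 <= quad M x).
Hypothesis M_eq0 : forall x, quad M x = 0 -> ker_ones x -> x = 0.
Hypotheses (sN : forall k, (N k)^T = N k) (NMN : forall k, N k *m M *m N k = N k).
Hypothesis ones_N : forall k, (const_mx 1 : 'rV_m) *m N k = 0.
Hypotheses (rho_gt0 : forall k, 0 < rho k) (rho1 : \sum_k rho k = 1).
Hypothesis connN : forall x : 'cV_m, (forall k, N k *m (M *m x) = 0) ->
  exists c, M *m x = const_mx c.
Local Notation F k := (1%:M - N k *m M).
Local Notation K := (mean_update rho (fun k => F k)).
Local Notation ones := (const_mx 1 : 'rV[R]_m).
Local Notation H := (M + ones^T *m ones).
Local Notation toC := (map_mx (real_complex R)).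

Lemma quadD p (A B : 'M[R]_p) x : quad (A + B) x = quad A x + quad B x.
Proof. by rewrite /quad mulmxDr mulmxDl mxE. Qed.

Lemma quadZ p a (A : 'M[R]_p) x : quad (a *: A) x = a * quad A x.
Proof. by rewrite /quad -scalemxAr -scalemxAl mxE. Qed.

Lemma quad_sum p (I : finType) (A : I -> 'M[R]_p) x :
  quad (\sum_k A k) x = \sum_k quad (A k) x.
Proof. by rewrite /quad mulmx_sumr mulmx_suml summxE. Qed.

Lemma quad_ones x : quad (ones^T *m ones) x = ((ones *m x) 0 0) ^+ 2.
Proof.
by rewrite /quad mulmxA -trmx_mul -mulmxA mxE big_ord1 !mxE expr2.
Qed.

(** [N k *m M] is idempotent and self-adjoint for [M], so [F k] is an [M]-orthogonal projection. *)
Lemma form_update k : (F k)^T *m M *m F k = M *m F k.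
Proof.
rewrite [X in X *m M *m _]linearB /= trmx1 trmx_mul sM sN !mulmxBl mul1mx.
have MNMN : M *m N k *m M *m N k = M *m N k.
  by rewrite -mulmxA -(mulmxA M) (mulmxA (N k)) NMN.
have -> : M *m N k *m M *m F k = 0.
  by rewrite mulmxBr mulmx1 [X in _ - X]mulmxA MNMN subrr.
by rewrite subr0.
Qed.

Lemma quad_update k x : quad M (F k *m x) = quad (M *m F k) x.
Proof. by rewrite /quad trmx_mul -form_update !mulmxA. Qed.

Lemma ones_update k : ones *m F k = ones.
Proof. by rewrite mulmxBr mulmx1 mulmxA ones_N mul0mx subr0. Qed.

Lemma ker_ones_update k x : ker_ones x -> ker_ones (F k *m x).
Proof. by move=> /ker_onesP x0; apply/ker_onesP; rewrite mulmxA ones_update. Qed.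

Lemma mean_updateE : K = 1%:M - (\sum_k rho k *: N k) *m M.
Proof.
rewrite mulmx_suml -[X in _ = X%:M - _]rho1 raddf_sum /= -sumrB.
by apply: eq_bigr => k _; rewrite scalerBr scalemx1 -scalemxAl.
Qed.

Lemma quad_mean_update x : quad (M *m K) x = \sum_k rho k * quad M (F k *m x).
Proof.
rewrite mulmx_sumr quad_sum; apply: eq_bigr => k _.
by rewrite quad_update -scalemxAr quadZ.
Qed.

Lemma ones_mean_update : ones *m K = ones.
Proof.
rewrite mulmx_sumr -[RHS]scale1r -[X in _ = X *: _]rho1 scaler_suml.
apply: eq_bigr => k _.
by rewrite -scalemxAr ones_update.
Qed.

Lemma sym_form : H^T = H.
Proof. by rewrite linearD /= sM trmx_mul trmxK. Qed.

Lemma form_gt0 x : x != 0 -> 0 < quad H x.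
Proof.
move=> x0; rewrite lt_def quadD quad_ones addr_ge0 ?sqr_ge0 // andbT.
apply: contra x0; rewrite paddr_eq0 ?sqr_ge0 // => /andP[/eqP Mx].
rewrite sqrf_eq0 => /eqP x1; apply/eqP; apply: M_eq0 => //.
by apply/ker_onesP/matrixP => i j; rewrite !ord1 x1 mxE.
Qed.

Lemma form_mean_update : H *m K = M *m K + ones^T *m ones.
Proof. by rewrite mulmxDl -mulmxA ones_mean_update. Qed.

Lemma sym_form_mean_update : (H *m K)^T = H *m K.
Proof.
rewrite form_mean_update linearD /= [(ones^T *m ones)^T]trmx_mul trmxK; congr (_ + _).
rewrite mulmx_sumr linear_sum; apply: eq_bigr => k _.
rewrite -scalemxAr linearZ /=; congr (_ *: _).
(* [M F_k] is rewritten as the congruence [F_k^T M F_k], whose symmetry follows from that of [M]. *)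
by rewrite -form_update !trmx_mul trmxK sM mulmxA.
Qed.

Lemma quad_pinv k y : quad (N k) y = quad M (N k *m y).
Proof. by rewrite /quad trmx_mul sN -[in LHS]NMN !mulmxA. Qed.

(** A fixed [x] satisfies [(sum_k rho_k N_k) M x = 0]. The forms [N_k] are nonnegative with positive
    weights, so each vanishes at [M x]; as [N_k M x] has zero sum, it is zero, and [connN]
    applies. *)
Lemma mean_update_fixed (x : 'cV[R]_m) : K *m x = x -> exists c, M *m x = const_mx c.
Proof.
rewrite mean_updateE mulmxBl mul1mx -[RHS]subr0 => /addrI /oppr_inj.
rewrite -mulmxA => Nx; apply: connN => k.
have : quad (\sum_k rho k *: N k) (M *m x) = 0.
  by rewrite /quad -mulmxA Nx mulmx0 mxE.
rewrite quad_sum => /eqP; rewrite psumr_eq0 => [/allP /(_ k)|j _]; last first.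
  by rewrite quadZ quad_pinv mulr_ge0 // ltW.
rewrite mem_index_enum => /(_ isT); rewrite quadZ quad_pinv mulf_eq0 gt_eqF //=.
move=> /eqP q0; apply: M_eq0 q0 _.
by apply/ker_onesP; rewrite mulmxA ones_N mul0mx.
Qed.

(** Ensures that the maximum defining [beta] is over a nonempty set: otherwise [M x] would be
    constant, and [x^T M x = 0], for a nonzero [x] of zero sum. *)
Lemma mean_update_neq1 : K != 1%:M.
Proof.
apply/eqP => K1; have fix_all (x : 'cV[R]_m) : exists c, M *m x = const_mx c.
  by apply: mean_update_fixed; rewrite K1 mul1mx.
(* The basis vector of index 1 minus that of index 0, as [m_ge2] also reads [1 < m]. *)
pose x : 'cV[R]_m := \col_i ((i == Ordinal m_ge2)%:R - (i == Ordinal (ltnW m_ge2))%:R).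
have x1 : ker_ones x.
  rewrite /ker_ones /=; under eq_bigr do rewrite mxE.
  have sum1 (j : 'I_m) : \sum_i (i == j)%:R = 1 :> R.
    by rewrite (bigD1 j) //= eqxx big1 ?addr0 // => i /negbTE ->.
  by rewrite sumrB !sum1 subrr.
have [c Mx] := fix_all x.
have : x = 0.
  apply: M_eq0 => //; rewrite /quad -mulmxA Mx.
  rewrite (_ : const_mx c = c *: ones^T); last first.
    by apply/colP => i; rewrite !mxE mulr1.
  move/ker_onesP: x1 => x1.
  by rewrite -scalemxAr -trmx_mul x1 trmx0 scaler0 mxE.
move=> /matrixP/(_ (Ordinal m_ge2) 0); rewrite !mxE eqxx subr0 => /eqP.
by rewrite oner_eq0.
Qed.

(** The columns of [T^-1] are eigenvectors of [K]. Since [K] and the eigenvalue are real, the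
    eigenvector equation splits into real and imaginary parts. *)
Lemma real_eigvec (T : 'M[R[i]]_m) (e : 'rV[R]_m) (i : 'I_m)
    (x := col i (invmx T)) :
    T \in unitmx -> T *m toC K = diag_mx (toC e) *m T ->
  K *m map_mx (@complex.Re R) x = e 0 i *: map_mx (@complex.Re R) x /\
  K *m map_mx (@complex.Im R) x = e 0 i *: map_mx (@complex.Im R) x.
Proof.
move=> uT TK.
have : toC K *m x = (e 0 i)%:C%C *: x.
  have -> : toC K = invmx T *m (diag_mx (toC e) *m T) by rewrite -TK mulKmx.
  rewrite /x colE !mulmxA mulmxK // -mulmxA scalemxAr mul_diag_mx.
  congr (_ *m _); apply/colP => j; rewrite !mxE.
  by case: eqP => [->|]; rewrite ?mulr0.
move: x => y /matrixP Kx; split; apply/matrixP => j k; rewrite !ord1.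
  have := congr1 (@complex.Re R) (Kx j 0); rewrite !mxE Re_sum Re_scale => <-.
  by apply: eq_bigr => j' _; rewrite !mxE Re_scale.
have := congr1 (@complex.Im R) (Kx j 0); rewrite !mxE Im_sum Im_scale => <-.
by apply: eq_bigr => j' _; rewrite !mxE Im_scale.
Qed.

(** [c] is the Rayleigh quotient of [H K] relative to [H]. It is nonnegative by [quad_mean_update],
    and at most 1 because [M F_k = M - M N_k M] with [M N_k M] positive semidefinite. *)
Lemma eigval_bounds (a : 'cV[R]_m) (c : R) : a != 0 -> K *m a = c *: a -> 0 <= c <= 1.
Proof.
move=> a0 Ka; have Ha := form_gt0 a0.
have : quad (H *m K) a = c * quad H a.
  by rewrite {1}/quad -!mulmxA Ka -!scalemxAr !mulmxA mxE.
rewrite form_mean_update [LHS]quadD quad_ones quad_mean_update => e.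
apply/andP; split.
  rewrite -(pmulr_lge0 _ Ha) -e addr_ge0 ?sqr_ge0 //; apply: sumr_ge0 => k _.
  by rewrite mulr_ge0 // ltW.
rewrite -(ler_pM2r Ha) mul1r -e.
rewrite quadD quad_ones lerD2r -[leRHS]mul1r -[X in _ <= X * _]rho1 mulr_suml.
apply: ler_sum => k _.
rewrite ler_pM2l // quad_update mulmxBr mulmx1 quadD gerDl.
rewrite -scaleN1r quadZ mulN1r oppr_le0.
have -> : quad (M *m (N k *m M)) a = quad (N k) (M *m a).
  by rewrite /quad trmx_mul sM !mulmxA.
by rewrite quad_pinv.
Qed.

Lemma mean_update_spectral : exists beta : R,
  [/\ is_max (nonunit_eigenvalue_moduli K) beta, 0 <= beta, beta < 1
    & forall x, ker_ones x ->
        \sum_k rho k * quad M (F k *m x) <= beta * quad M x].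
Proof.
have [T [e [uT TT TK]]] :=
  selfadjoint_diagonalization sym_form form_gt0 sym_form_mean_update.
have col_neq0 i : col i (invmx T) != 0.
  apply/eqP => c0; have /matrixP/(_ i i) := mulmxV uT.
  rewrite !mxE eqxx; move/matrixP: c0 => c0.
  rewrite big1 => [/esym/eqP|j _]; first by rewrite oner_eq0.
  by have := c0 j 0; rewrite !mxE => ->; rewrite mulr0.
have e01 i : 0 <= e 0 i <= 1.
  have [Ka Kb] := real_eigvec i uT TK.
  have := col_neq0 i; move: Ka Kb; set x := col i (invmx T) => Ka Kb x0.
  have [a0|/eigval_bounds a0] := eqVneq (map_mx (@complex.Re R) x) 0;
    last exact: a0.
  have [b0|/eigval_bounds b0] := eqVneq (map_mx (@complex.Im R) x) 0;
    last exact: b0.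
  by move: x0; rewrite (toC_rect x) a0 b0 !map_mx0 scaler0 addr0 eqxx.
have [i0 i0P] : exists i, e 0 i != 1.
  apply/existsP; apply: contraT; rewrite negb_exists => /forallP e1.
  have e_const : diag_mx (toC e) = 1%:M.
    rewrite -diag_const_mx; congr diag_mx; apply/rowP => i; rewrite !mxE.
    by have := e1 i; rewrite negbK => /eqP ->.
  have := mean_update_neq1; apply: contraNT => _; apply/eqP.
  apply: (map_mx_inj (f := real_complex R)); rewrite map_mx1.
  by apply: (can_inj (mulKmx uT)); rewrite TK e_const mul1mx mulmx1.
(* [beta] is the largest diagonal entry different from 1; all entries being nonnegative, they are
   their own moduli. *)
have [i1 i1P i1max] := @arg_maxP _ _ _ i0 (fun i => e 0 i != 1) (fun i => e 0 i) i0P.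
have e_ge0 i : 0 <= e 0 i by have /andP[] := e01 i.
exists (e 0 i1); split => //.
- split.
    exists (e 0 i1)%:C%C; last by rewrite normc_def /= expr0n addr0 sqrtr_sqr ger0_norm.
    split; last by apply: contra i1P => /eqP /complexI ->.
    (* [eigenvalue] refers to left eigenvectors, and the rows of [T] are such. *)
    apply/eigenvalueP; exists (row i1 T).
      by rewrite -row_mul TK mul_diag_mx; apply/rowP => j; rewrite !mxE.
    apply/eqP => r0; have : (row i1 T *m invmx T) 0 i1 = 1.
      by rewrite -row_mul mulmxV // !mxE eqxx.
    by rewrite r0 mul0mx mxE => /esym/eqP; rewrite oner_eq0.
  move=> _ [lam [/eigenvalueP[v vK v0] lam1] <-].
  (* The coordinates of [v] in the basis of rows of [T]: any nonzero one identifies [lam] with a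
     diagonal entry. *)
  pose w := v *m invmx T.
  have wl : w *m diag_mx (toC e) = lam *: w.
    rewrite /w scalemxAl -vK -!mulmxA; congr (_ *m _).
    by apply: (can_inj (mulmxK uT)); rewrite mulmxKV // -mulmxA -TK mulKmx.
  have w0 : w != 0.
    by apply: contra v0 => /eqP w0; rewrite -(mulmxKV uT v) -/w w0 mul0mx.
  have [i wi] : exists i, w 0 i != 0.
    apply/existsP; move: w0; apply: contraNT; rewrite negb_exists => /forallP h.
    apply/eqP/rowP => i; rewrite [RHS]mxE; apply/eqP.
    by have := h i; rewrite negbK.
  have : (e 0 i)%:C%C = lam.
    move/rowP: wl => /(_ i); rewrite mul_mx_diag [LHS]mxE [RHS]mxE => h.
    by apply: (mulIf wi); rewrite -h mulrC; congr (_ * _); rewrite mxE.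
  move=> lamE; rewrite -lamE normc_def /= expr0n addr0 sqrtr_sqr ger0_norm //.
  by apply: i1max; apply: contra lam1 => /eqP e1; rewrite -lamE e1.
- by rewrite lt_neqAle i1P; have /andP[] := e01 i1.
- move=> x x0; rewrite -quad_mean_update.
  have x1 : ones *m x = 0 by apply/ker_onesP.
  have -> : quad (M *m K) x = quad (H *m K) x.
    by rewrite form_mean_update quadD quad_ones x1 mxE expr0n addr0.
  have -> : quad M x = quad H x by rewrite quadD quad_ones x1 mxE expr0n addr0.
  (* In these coordinates [H] becomes the standard hermitian form and [H K] the diagonal one with
     entries [e], so the bound is checked coordinate by coordinate. *)
  pose y := T *m toC x.
  have normE (s : 'rV[R]_m) :
      (y^t* *m diag_mx (toC s) *m y) 0 0
      = \sum_i (s 0 i)%:C%C * (y i 0 * (y i 0)^*).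
    rewrite mul_mx_diag mxE; apply: eq_bigr => i _; rewrite !mxE.
    by rewrite mulrAC mulrC; congr (_ * _); rewrite mulrC.
  have HE : (quad H x)%:C%C = \sum_i y i 0 * (y i 0)^*.
    transitivity ((y^t* *m diag_mx (toC (const_mx 1)) *m y) 0 0).
      rewrite map_const_mx diag_const_mx mulmx1 /y adjM mulmxA -(mulmxA _ (T^t* )) TT.
      by rewrite toC_adj -!map_mxM [RHS]mxE.
    by rewrite normE; apply: eq_bigr => i _; rewrite mxE mul1r.
  have HKE : (quad (H *m K) x)%:C%C = \sum_i (e 0 i)%:C%C * (y i 0 * (y i 0)^*).
    rewrite -normE /y adjM -!mulmxA (mulmxA _ T) -TK -(mulmxA T) (mulmxA (T^t* )) TT.
    by rewrite toC_adj -!map_mxM [RHS]mxE /quad !mulmxA.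
  rewrite -lecR HKE rmorphM /= HE mulr_sumr; apply: ler_sum => i _.
  have [ei1|ei1] := eqVneq (e 0 i) 1; last first.
    by rewrite ler_wpM2r ?mul_conjC_ge0 // lecR; exact: i1max.
  (* Where the eigenvalue is 1 the coordinate vanishes: it is the [H]-product of [x] with a fixed
     vector of [K], and [x] has zero sum. *)
  suff -> : y i 0 = 0 by rewrite mul0r !mulr0.
  have fixed_orth (a : 'cV[R]_m) : K *m a = e 0 i *: a -> a^T *m H *m x = 0.
    rewrite ei1 scale1r => /mean_update_fixed[c Ma].
    rewrite mulmxDr mulmxDl -!mulmxA x1 !mulmx0 addr0 mulmxA -{1}sM -trmx_mul Ma.
    rewrite (_ : const_mx c = c *: ones^T); last first.
      by apply/colP => j; rewrite !mxE mulr1.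
    by rewrite linearZ /= trmxK -scalemxAl x1 scaler0.
  have [/fixed_orth Ka /fixed_orth Kb] := real_eigvec i uT TK.
  pose x0i := col i (invmx T).
  have : x0i^t* *m toC H *m toC x = 0.
    rewrite (toC_rect x0i) linearD /= map_mxD toC_adj.
    rewrite linearZ /= map_mxZ toC_adj !mulmxDl -!scalemxAl -!map_mxM Ka Kb.
    by rewrite map_mx0 scaler0 addr0.
  rewrite -TT mulmxA -adjM -mulmxA -/y.
  have -> : (T *m x0i)^t* = delta_mx 0 i.
    rewrite /x0i colE mulmxA mulmxV // mul1mx.
    by apply/rowP => j; rewrite !mxE rmorph_nat andbC.
  by rewrite -rowE => /matrixP/(_ 0 0); rewrite !mxE.
Qed.

End MeanUpdate.

(** * Expectations along the random trajectory *)

Section Expectation.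
Context {d : measure_display} {T : measurableType d} {R : realType}.
Variables (P : probability T R) (m l : nat) (F : 'I_l -> 'M[R]_m).
Variables (r : nat -> T -> 'I_l) (rho : 'I_l -> R) (x0 : 'cV[R]_m).
Hypothesis iid_r : iid P r rho.

(** Written as an intersection over a duplicate-free sequence, the shape that [mutually_independent]
    expects. *)
Definition cylinder (t : nat) (f : nat -> 'I_l) : set T :=
  \bigcap_(i in [set` index_iota 0 t]) (r i @^-1` [set f i]).

Definition extend (f : nat -> 'I_l) (t : nat) (k : 'I_l) : nat -> 'I_l :=
  fun i => if i == t then k else f i.

Lemma cylinderP t f w : cylinder t f w <-> forall i, (i < t)%N -> r i w = f i.
Proof.
split=> [c i it|c i]; last by rewrite /= mem_index_iota; exact: c.
by have := c i; rewrite /= mem_index_iota; exact.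
Qed.

Lemma cylinder_extendP t f k w :
  cylinder t.+1 (extend f t k) w <-> cylinder t f w /\ r t w = k.
Proof.
rewrite !cylinderP; split => [c|[c rk] i].
  split=> [i it|]; last by rewrite c // /extend eqxx.
  by rewrite c ?ltnS 1?ltnW // /extend ltn_eqF.
by rewrite ltnS leq_eqVlt /extend => /predU1P[->|it]; rewrite ?eqxx // ltn_eqF ?c.
Qed.

Lemma measurable_cylinder t f : measurable (cylinder t f).
Proof.
case: iid_r => mr _ _; rewrite /cylinder bigcap_seq; apply: bigsetI_measurable => i _.
exact: mr.
Qed.

Lemma probability_cylinder t f :
  P (cylinder t f) = (\prod_(0 <= i < t) rho (f i))%:E.
Proof.
case: iid_r => mr ind Pr; rewrite ind ?iota_uniq //.
by rewrite -prodEFin; apply: eq_bigr => i _; exact: Pr.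
Qed.

Lemma prob_sum1 : \sum_k rho k = 1.
Proof.
case: iid_r => mr _ Pr; apply: EFin_inj; rewrite -sumEFin -(probability_setT P).
rewrite (_ : setT = \big[setU/set0]_k (r 0%N @^-1` [set k])); last first.
  rewrite -bigcup_seq; apply/seteqP; split => w _ //.
  by exists (r 0%N w); rewrite //= mem_index_enum.
rewrite measure_semi_additive_ord => [|k|i j _ _ [w [/= <- <-]]|] //.
- by apply: eq_bigr => k _; exact/esym/Pr.
- exact: mr.
- by apply: bigsetU_measurable => k _; exact: mr.
Qed.

Lemma trajectory_cylinder t f w : cylinder t f w ->
  trajectory F (r ^~ w) x0 t = trajectory F f x0 t.
Proof.
rewrite cylinderP; elim: t => //= t IH c; rewrite c // IH // => i it.
by apply: c; rewrite ltnS ltnW.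
Qed.

Lemma trajectory_eq t (f f' : nat -> 'I_l) : (forall i, (i < t)%N -> f i = f' i) ->
  trajectory F f x0 t = trajectory F f' x0 t.
Proof.
elim: t => //= t IH c; rewrite c // IH // => i it.
by apply: c; rewrite ltnS ltnW.
Qed.

(** [B] can be arbitrary: the state after [t] steps depends only on finitely many discrete
    indices. *)
Lemma measurable_trajectory t (B : set 'cV[R]_m) :
  measurable [set w | B (trajectory F (r ^~ w) x0 t)].
Proof.
elim: t B => [|t IH] B /=.
  have [Bx|Bx] := pselect (B x0).
    by rewrite [X in measurable X](_ : _ = setT) //; apply/seteqP; split.
  by rewrite [X in measurable X](_ : _ = set0) //; apply/seteqP; split.
rewrite [X in measurable X](_ : _ = \big[setU/set0]_k
  ((r t @^-1` [set k]) `&` [set w | B (F k *m trajectory F (r ^~ w) x0 t)])); last first.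
  rewrite -bigcup_seq; apply/seteqP; split => w /= => [Bw|[k _ [/= -> //]]].
  by exists (r t w) => //=; rewrite mem_index_enum.
apply: bigsetU_measurable => k _; apply: measurableI.
  by case: iid_r => mr _ _; exact: mr.
exact: (IH [set x | B (F k *m x)]).
Qed.

Variable g : 'cV[R]_m -> R.
Hypothesis g_ge0 : forall x, 0 <= g x.

(** The [k]-th iterate of the transition operator of the Markov chain, applied to [g]. *)
Fixpoint averaged (k : nat) (x : 'cV[R]_m) : R :=
  if k is k'.+1 then \sum_j rho j * averaged k' (F j *m x) else g x.

Lemma measurable_fun_trajectory t (D : set T) :
  measurable_fun D (EFin \o (fun w => g (trajectory F (r ^~ w) x0 t))).
Proof.
apply: (measurable_funS measurableT) => // _ Y mY; rewrite setTI.
exact: (measurable_trajectory t [set x | Y (g x)%:E]).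
Qed.

(** Elementary form of the Markov property: [t] draws are prescribed and [k] remain. The induction
    on [k] splits the cylinder according to the next draw. *)
Lemma integral_cylinder k t f :
  (\int[P]_(w in cylinder t f) (g (trajectory F (r ^~ w) x0 (k + t)))%:E
   = ((\prod_(0 <= i < t) rho (f i)) * averaged k (trajectory F f x0 t))%:E)%E.
Proof.
elim: k t f => [|k IH] t f /=.
  rewrite (eq_integral (cst (g (trajectory F f x0 t))%:E)); last first.
    by move=> w; rewrite inE => /trajectory_cylinder; rewrite add0n => ->.
  rewrite integral_cst; last exact: measurable_cylinder.
  by rewrite [X in (_ * X)%E](probability_cylinder t f) -EFinM mulrC.
have cylU : cylinder t f = \big[setU/set0]_j cylinder t.+1 (extend f t j).
  rewrite -bigcup_seq; apply/seteqP; split => w => [c|[j _ /cylinder_extendP[]//]].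
  by exists (r t w); [rewrite /= mem_index_enum|exact/cylinder_extendP].
rewrite cylU ge0_integral_bigsetU //=.
- rewrite mulr_sumr -sumEFin; apply: eq_bigr => j _.
  have := IH t.+1 (extend f t j); rewrite addnS /= => ->.
  rewrite big_nat_recr //= /extend eqxx (trajectory_eq (f' := f)); last first.
    by move=> i it; rewrite ltn_eqF.
  rewrite -mulrA; congr ((_ * _)%:E); apply: eq_big_nat => i /andP[_ it].
  by rewrite ltn_eqF.
- by move=> j; exact: measurable_cylinder.
- exact: index_enum_uniq.
- by move=> i j _ _ [w [/cylinder_extendP[_ <-] /cylinder_extendP[_ <-]]].
- exact: (measurable_fun_trajectory (k + t).+1).
- by move=> w _; rewrite lee_fin.
Qed.

(** The cylinder of length 0 along [f] is the whole space. *)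
Lemma expectation_trajectory (f : nat -> 'I_l) t :
  ('E_P[fun w => g (trajectory F (r ^~ w) x0 t)] = (averaged t x0)%:E)%E.
Proof.
have := integral_cylinder t 0 f; rewrite addn0 big_geq // mul1r /= => <-.
rewrite unlock (_ : cylinder 0 f = setT) //.
by apply/seteqP; split => // w _; exact/cylinderP.
Qed.

End Expectation.

(** * Limits superior of roots of geometrically bounded sequences *)

Section Rate.
Context {R : realType}.

Lemma limn_esup_le (u v : (\bar R)^nat) (b : \bar R) :
  (\forall t \near \oo, (u t <= v t)%E) -> v @ \oo --> b -> (limn_esup u <= b)%E.
Proof.
move=> [N _ uv] vb; rewrite -(cvg_limn_einf_sup vb).2 !limn_esup_lim.
apply: lee_lim; [exact: is_cvg_esups|exact: is_cvg_esups|].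
exists N => // k /= Nk; apply: ge_ereal_sup => _ [i /= ki <-].
apply: (@le_trans _ _ (v i)); first exact/uv/(leq_trans Nk).
by apply: ereal_sup_ubound; exists i.
Qed.

Lemma root_cvg1 (c : R) : 0 < c -> (c `^ (t%:R^-1)) @[t --> \oo] --> (1 : R).
Proof.
move=> c0; suff : expR (t%:R^-1 * ln c) @[t --> \oo] --> expR (0 * ln c).
  by rewrite mul0r expR0 => h; under eq_cvg do rewrite /powR gt_eqF //.
apply: continuous_cvg; first exact: continuous_expR.
apply: cvgM; last exact: cvg_cst.
(* [harmonic] is the sequence [1 / (t + 1)], hence the shift. *)
by rewrite -cvg_shiftS; exact: cvg_harmonic.
Qed.

Lemma limn_esup_root_le (u : nat -> R) (b c : R) : 0 <= b -> 0 <= c ->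
  (forall t, 0 <= u t <= b ^+ t * c) ->
  (limn_esup (fun t => ((u t)%:E `^ (t%:R^-1)%R)%E) <= b%:E)%E.
Proof.
(* [c + 1] is positive even if [c = 0], so its [t]-th root tends to 1. *)
move=> b0 c0 uP; have c1 : 0 < c + 1 by rewrite ltr_wpDl.
apply: (@limn_esup_le _ (fun t => (b * (c + 1) `^ t%:R^-1)%:E)).
  (* The comparison starts at [t = 1], where [t * t^-1 = 1] becomes available. *)
  exists 1%N => // t t1; rewrite poweR_EFin lee_fin.
  have /andP[u0 ub] := uP t.
  rewrite (@le_trans _ _ ((b ^+ t * (c + 1)) `^ t%:R^-1)) //.
    apply: ge0_ler_powR; rewrite ?nnegrE ?invr_ge0 ?ler0n ?mulr_ge0 ?exprn_ge0 //.
      exact: ltW.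
    by rewrite (le_trans ub) // ler_wpM2l ?exprn_ge0 // lerDl.
  rewrite powRM ?exprn_ge0 ?(ltW c1) // -powR_mulrn // -powRrM mulfV ?powRr1 //.
  by rewrite pnatr_eq0 -lt0n.
apply: cvg_EFin; first by near=> t.
rewrite -[X in _ --> X]mulr1; apply: cvgM; [exact: cvg_cst|exact: root_cvg1].
Unshelve. all: by end_near.
Qed.

End Rate.

(** Iterates a one-step contraction in mean known only on an invariant set [S], here the vectors of
    zero sum. *)
Lemma averaged_bound (R : realType) (m l : nat) (F : 'I_l -> 'M[R]_m)
    (rho : 'I_l -> R) (g : 'cV[R]_m -> R) (S : set 'cV[R]_m) (b : R) :
  0 <= b -> (forall k, 0 <= rho k) -> (forall x, 0 <= g x) ->
  (forall k x, S x -> S (F k *m x)) ->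
  (forall x, S x -> \sum_k rho k * g (F k *m x) <= b * g x) ->
  forall t x, S x -> 0 <= averaged F rho g t x <= b ^+ t * g x.
Proof.
move=> b0 rho0 g0 FS gb; elim=> [|t IH] x Sx /=; first by rewrite g0 expr0 mul1r lexx.
apply/andP; split.
  by apply: sumr_ge0 => k _; rewrite mulr_ge0 //; have /andP[] := IH _ (FS k x Sx).
rewrite exprSr -mulrA; apply: (@le_trans _ _ (b ^+ t * \sum_k rho k * g (F k *m x))).
  rewrite mulr_sumr; apply: ler_sum => k _; rewrite mulrCA ler_wpM2l //.
  by have /andP[] := IH _ (FS k x Sx).
by rewrite ler_wpM2l ?exprn_ge0 ?gb.
Qed.

(** * Restriction from the network to the compensators *)

Section Compensators.
Variables (R : realType) (n : nat) (C : {set 'I_n}) (X : 'M[R[i]]_n).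
Local Notation M := (compensator_matrix X C).

(** Pads a vector indexed by [C] with zeros, which preserves its sum and turns the form [M] into
    that of [Re(X)]. *)
Definition extension : 'M[R]_(n, #|C|) := \matrix_(v, i) (v == enum_val i)%:R.

Lemma row_extension p (A : 'M[R]_(n, p)) i j : (extension^T *m A) i j = A (enum_val i) j.
Proof.
rewrite mxE (bigD1 (enum_val i)) //= big1 ?addr0 => [|v /negbTE vi].
  by rewrite !mxE eqxx mul1r.
by rewrite !mxE vi mul0r.
Qed.

Lemma quad_compensator x :
  quad M x = quad (map_mx (@complex.Re R) X) (extension *m x).
Proof.
have -> : M = extension^T *m map_mx (@complex.Re R) X *m extension.
  apply/matrixP => i j; rewrite -mulmxA row_extension.
  rewrite [RHS]mxE (bigD1 (enum_val j)) //= big1 ?addr0 => [|v /negbTE vj].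
    by rewrite !mxE eqxx mulr1.
  by rewrite !mxE vj mulr0.
by rewrite /quad trmx_mul !mulmxA.
Qed.

Lemma extension_eq0 (x : 'cV_#|C|) : extension *m x = 0 -> x = 0.
Proof.
move=> x0; apply/colP => i; have /colP/(_ (enum_val i)) := x0.
rewrite !mxE (bigD1 i) //= big1 ?addr0 => [|j ji].
  by rewrite mxE eqxx mul1r.
by rewrite mxE (inj_eq enum_val_inj) eq_sym (negbTE ji) mul0r.
Qed.

Lemma sum_extension (x : 'cV_#|C|) : \sum_v (extension *m x) v 0 = \sum_i x i 0.
Proof.
under eq_bigr do rewrite mxE.
rewrite exchange_big /=; apply: eq_bigr => i _.
rewrite (bigD1 (enum_val i)) //= big1 ?addr0 => [|v /negbTE vi].
  by rewrite mxE eqxx mul1r.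
by rewrite mxE vi mul0r.
Qed.

Lemma clusters_const l (Cl : 'I_l -> {set 'I_n}) (y : 'I_#|C| -> R) :
  (forall k, Cl k \subset C) -> clusters_connected C Cl ->
  (forall k i j, enum_val i \in Cl k -> enum_val j \in Cl k -> y i = y j) ->
  forall i j, y i = y j.
Proof.
move=> ClC conn y_const i j.
have [r [s [iCr jCs /connectP[p rp sp]]]] := conn _ _ (enum_valP i) (enum_valP j).
elim: p r i rp sp iCr => [|a p IH] r i /=.
  by move=> _ sr iCr; apply: (y_const r) => //; rewrite -sr.
(* A node [v] shared by two consecutive clusters of the chain passes the value of [y] from one to
   the next. *)
move=> /andP[/pred0Pn[v /andP[/= vr va]] ap] sp ir.
have vC : v \in C by apply: (fintype.subsetP (ClC r)).
have vE := enum_rankK_in vC vC.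
by rewrite (y_const r i (enum_rank_in vC v)) ?vE //; apply: (IH a); rewrite ?vE.
Qed.

End Compensators.

(** * Bound on the mean-square convergence rate *)

Theorem theorem7 (R : realType)
    (n p : nat) (o : 'I_n) (sigma tau : 'I_p -> 'I_n) (z : 'I_p -> R[i])
    (X : 'M[R[i]]_n)
    (C : {set 'I_n}) (l : nat) (Cl : 'I_l -> {set 'I_n})
    (d : measure_display) (T : measurableType d) (P : probability T R)
    (r : nat -> T -> 'I_l) (rho : 'I_l -> R)
    (noloop : forall e, sigma e != tau e)
    (connG : graph_connected sigma tau)
    (zpos : forall e, 0 < complex.Re (z e))
    (greenX : is_green_matrix sigma tau z o X)
    (cardC : (2 <= #|C|)%N)
    (Cl_neq0 : forall k, Cl k != finset.set0)
    (Cl_cover : (\bigcup_k Cl k)%SET = C)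
    (connH : clusters_connected C Cl)
    (rho_gt0 : forall k, 0 < rho k)
    (iid_r : iid P r rho) :
  let M := compensator_matrix X C in
  let F := fun k => cluster_update M (Cl k) in
  exists beta : R,
    [/\ is_max (nonunit_eigenvalue_moduli (mean_update rho F)) beta,
        (convergence_rate P M F r <= beta%:E)%E
      & beta < 1].
Proof.
move=> M F.
have ClC k : Cl k \subset C by rewrite -Cl_cover; exact: finset.bigcup_sup.
have sM : M^T = M.
  by case: greenX => sX _ _; apply/matrixP => i j; rewrite !mxE -{1}sX mxE.
have M_ge0 x : 0 <= quad M x.
  by rewrite quad_compensator; exact: (quad_green_ge0 zpos greenX).
have M_eq0 x : quad M x = 0 -> ker_ones x -> x = 0.
  rewrite quad_compensator => /(quad_green_eq0 zpos greenX) q0 x0.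
  by apply/extension_eq0/q0; rewrite sum_extension.
pose Om k := cluster_proj R C (Cl k).
have sOm k : (Om k)^T = Om k by exact: cluster_proj_sym.
have OmOm k : Om k *m Om k = Om k by exact: cluster_proj_idem.
have ones_Om k : const_mx 1 *m Om k = 0 :> 'rV_#|C| by exact: ones_cluster_proj.
pose N k := mp_pinv (Om k *m M *m Om k).
have ones_N k : const_mx 1 *m N k = 0 :> 'rV_#|C| by exact: ones_pinv.
have connN (x : 'cV_#|C|) : (forall k, N k *m (M *m x) = 0) ->
    exists c, M *m x = const_mx c.
  move=> Nx; exists ((M *m x) (Ordinal cardC) 0); apply/colP => i; rewrite [RHS]mxE.
  apply: (clusters_const (y := fun i => (M *m x) i 0) ClC connH) => k a b ak bk.
  apply: cluster_proj_eq0 ak bk.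
  exact: (pinv_eq0 sM M_eq0 (sOm k) (ones_Om k) (Nx k)).
have [beta [beta_max beta_ge0 beta_lt1 beta_contr]] :=
  mean_update_spectral cardC sM M_ge0 M_eq0
    (fun k => pinv_sym sM (sOm k)) (fun k => pinv_reflexive sM (sOm k) (OmOm k))
    ones_N rho_gt0 (prob_sum1 iid_r) connN.
exists beta; split => //.
(* Some compensator lies in a cluster, which supplies the index [k0] for the constant sequence given
   to [expectation_trajectory]. *)
have u0C := enum_valP (Ordinal cardC).
have [k0 _] := connH _ _ u0C u0C.
apply: ge_ereal_sup => _ [x0 x0V <-].
rewrite [X in (limn_esup X <= _)%E](_ : _ = fun t =>
    ((averaged F rho (quad M) t x0)%:E `^ (t%:R^-1)%R)%E); last first.
  apply/funext => t; congr (_ `^ _)%E.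
  exact: (expectation_trajectory F x0 iid_r M_ge0 (fun=> k0)).
apply: (limn_esup_root_le beta_ge0 (M_ge0 x0)) => t.
apply: (averaged_bound (S := @ker_ones R #|C|)) => //.
- by move=> k; exact: ltW.
- by move=> k x; exact: (@ker_ones_update _ _ _ M N ones_N k x).
Qed.
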